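(* Let $k$ be a positive integer and let $n$ be an integer with $n\ge k^2+2k$. Then every partition of $n$ can be reconstructed from its set of $k$-deletions; that is, if $\lambda$ and $\nu$ are partitions of $n$ such that the set of $k$-deletions of $\lambda$ equals the set of $k$-deletions of $\nu$, then $\lambda=\nu$.
   Context: A partition of $n$, $\lambda=(\lambda_1,\dots,\lambda_\ell)$, is a finite nonincreasing sequence of positive integers whose sum, denoted $|\lambda|$, is $n$; set $\lambda_i=0$ for $i>\ell$ (so trailing zeros are ignored). A partition is identified with its Ferrers diagram, consisting of left-justified rows where row $i$ has $\lambda_i$ cells. Write $\mu\le\lambda$ if $\mu_i\le\lambda_i$ for all $i$ (containment of diagrams). When $\mu\le\lambda$, $\lambda/\mu$ denotes the set of cells which lie in $\lambda$ but not in $\mu$, so it has $|\lambda|-|\mu|$ cells. A partition $\mu$ is a $k$-deletion of $\lambda$ if $\mu\le\lambda$ and $\lambda/\mu$ has exactly $k$ cells, i.e. $|\mu|=|\lambda|-k$. The set of $k$-deletions is a set, without multiplicities. *)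

(* Defs.v *)
From mathcomp Require Import all_boot.
Set Implicit Arguments.
Unset Strict Implicit.
Unset Printing Implicit Defensive.

(* Rows and columns are numbered from 0, and [nth 0] supplies the convention
   that parts beyond the last one are 0.  As all parts are positive, distinct
   sequences are distinct partitions. *)
Definition is_partition (lam : seq nat) : bool :=
  sorted geq lam && all (leq 1) lam.

Definition is_partition_of (n : nat) (lam : seq nat) : bool :=
  is_partition lam && (sumn lam == n).

Definition contained (mu lam : seq nat) : Prop :=
  forall i : nat, nth 0 mu i <= nth 0 lam i.

Definition cells (lam : seq nat) : seq (nat * nat) :=
  [seq (i, j) | i <- iota 0 (size lam), j <- iota 0 (nth 0 lam i)].

Definition skew_cells (lam mu : seq nat) : seq (nat * nat) :=
  [seq c <- cells lam | c \notin cells mu].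

Definition is_deletion (k : nat) (lam mu : seq nat) : Prop :=
  [/\ is_partition mu, contained mu lam & size (skew_cells lam mu) = k].

Lemma mem_cells (lam : seq nat) (i j : nat) :
  ((i, j) \in cells lam) = (j < nth 0 lam i).
Proof.
apply/allpairsPdep/idP => [[i' [j' [_ jlt [-> ->]]]]|jlt].
  by move: jlt; rewrite mem_iota.
exists i, j; split=> //; rewrite mem_iota //=.
by rewrite add0n; case: ltnP => // le_i; rewrite nth_default in jlt.
Qed.

Lemma cells_uniq (lam : seq nat) : uniq (cells lam).
Proof.
apply: allpairs_uniq_dep => [|i _|[i j] [i' j'] _ _ /= [-> ->]] //;
by rewrite iota_uniq.
Qed.

Lemma size_cells (lam : seq nat) : size (cells lam) = sumn lam.
Proof.
rewrite size_allpairs_dep; congr sumn.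
rewrite -[RHS](mkseq_nth 0) /mkseq.
by apply: eq_map => i; rewrite size_iota.
Qed.

(* Hence [size] counts each cell of lam/mu once and has value |lam| - |mu|. *)
Lemma skew_cells_uniq (lam mu : seq nat) : uniq (skew_cells lam mu).
Proof. by rewrite filter_uniq ?cells_uniq. Qed.

Lemma size_skew_cells (lam mu : seq nat) :
  contained mu lam -> size (skew_cells lam mu) + sumn mu = sumn lam.
Proof.
move=> le_mu_lam; rewrite -!size_cells size_filter addnC.
rewrite -(count_predC (mem (cells mu)) (cells lam)); congr addn.
rewrite -size_filter; apply/perm_size/uniq_perm; rewrite ?filter_uniq ?cells_uniq //.
move=> [i j]; rewrite mem_filter /= !mem_cells.
by case: ltnP => //= /leq_trans ->.
Qed.

Lemma is_deletionP (k : nat) (lam mu : seq nat) :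
  is_deletion k lam mu <->
  [/\ is_partition mu, contained mu lam & sumn mu + k = sumn lam].
Proof.
split=> -[mu_part le_mu sz]; split=> //; move: (size_skew_cells le_mu).
  by rewrite sz addnC.
by rewrite -sz addnC => /addnI.
Qed.

(* Main.v *)
Require Import Defs.
From mathcomp Require Import all_boot.
From mathcomp Require Import zify.

(** Put N = n - k, so that k ^ 2 + k <= N.  A deletion of [lam] has N cells, so
    it contains no rectangle of area more than N.  Conversely every rectangle
    in [lam] of area at most N lies in some deletion of [lam], because the
    number of cells of a partition between two nested partitions can be
    prescribed ([intermediate_partition]).  Two partitions of n with the same
    deletions therefore contain the same rectangles of area at most N
    ([small_rectangle_transfer]).

    Suppose that they differ.  Having the same size, neither contains the
    other, so [lam] contains a rectangle a x b that [nu] lacks, and [nu]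
    contains a rectangle a' x b' that [lam] lacks.  Both areas exceed N, and
    neither rectangle contains the other, so that after exchanging [lam] and
    [nu] if necessary a < a' and b' < b.  Within [lam] fewer than k cells lie
    outside a x b, yet all small subrectangles of a' x b' are there; the same
    holds with the roles exchanged.  Counting the cells of these subrectangles
    ([sumn_two_rectangles]) leaves two possibilities.  Either a and b' are both
    less than k, and then the part of a x b that [nu] must contain is too
    large; or a + 1 and b' + 1 both exceed N / k, and then a x b has more than n
    cells.  This is [no_crossing_rectangles]. *)

(** * Nested partitions *)

Lemma is_partition_cons (x : nat) (s : seq nat) :
  is_partition (x :: s) = [&& 0 < x, nth 0 s 0 <= x & is_partition s].
Proof.
rewrite /is_partition; case: s => [|y s] /=; first by rewrite andbT.
by rewrite -!andbA; do !bool_congr.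
Qed.

Lemma nth_partition_le (s : seq nat) (i j : nat) :
  is_partition s -> i <= j -> nth 0 s j <= nth 0 s i.
Proof.
case/andP=> s_sorted _ le_ij.
have [lt_j|le_j] := ltnP j (size s); last by rewrite (nth_default _ le_j).
have geq_trans : transitive geq by move=> y x z /= le_yx /leq_trans; apply.
apply: (sorted_leq_nth geq_trans leqnn 0 s_sorted) => //.
by rewrite inE (leq_ltn_trans le_ij).
Qed.

Lemma contained_cons (x y : nat) (s t : seq nat) :
  contained (x :: s) (y :: t) <-> x <= y /\ contained s t.
Proof.
split=> [le_st|[le_xy le_st] [|i] //=].
by split; [apply: (le_st 0) | move=> i; apply: (le_st i.+1)].
Qed.

Lemma contained_nil (s : seq nat) : contained [::] s.
Proof. by move=> i; rewrite nth_nil. Qed.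

Lemma contained_sumn (mu lam : seq nat) :
  contained mu lam -> sumn mu <= sumn lam.
Proof. by move=> /size_skew_cells <-; apply: leq_addl. Qed.

Lemma contained_eq (mu lam : seq nat) :
  is_partition mu -> is_partition lam -> contained mu lam ->
  sumn mu = sumn lam -> mu = lam.
Proof.
elim: mu lam => [|x mu IHmu] [|y lam] //.
- by rewrite !is_partition_cons => _ /andP[y_gt0 _] _ /=; lia.
- by rewrite !is_partition_cons => /andP[x_gt0 _] _ _ /=; lia.
rewrite !is_partition_cons => /and3P[_ _ mu_part] /and3P[_ _ lam_part].
case/contained_cons=> le_xy le_mu /= sum_eq.
have le_sum := contained_sumn _ _ le_mu.
by congr (_ :: _); [lia | apply: IHmu => //; lia].
Qed.

(** Replace the rows of [kap] by those of [lam] one after the other from the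
    top, stopping inside the row where the size reaches m.  The result stays
    nonincreasing because a row of [lam], complete or not, is at least as long
    as the row of [kap] that it replaces. *)
Lemma intermediate_partition (kap lam : seq nat) (m : nat) :
  is_partition kap -> is_partition lam -> contained kap lam ->
  sumn kap <= m <= sumn lam ->
  exists mu, [/\ is_partition mu, contained kap mu, contained mu lam
               & sumn mu = m].
Proof.
elim: lam kap m => [|l lam IHlam] kap m kap_part.
  move=> _ le_kap /andP[_]; rewrite leqn0 => /eqP ->.
  by exists [::]; split.
rewrite is_partition_cons => /and3P[l_gt0 le_l lam_part] le_kap.
case/andP=> kap_le_m m_le.
have [kap'_part le_kap' le_kap0] : [/\ is_partition (behead kap),
    contained (behead kap) lam & nth 0 kap 0 <= l].
  case: kap kap_part le_kap {kap_le_m} => [|x kap].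
    by move=> _ _; split=> //; apply: contained_nil.
  rewrite is_partition_cons => /and3P[_ _ ->].
  by case/contained_cons.
have sum_kap : sumn kap = nth 0 kap 0 + sumn (behead kap) by case: (kap).
have [row_fits|row_large] := leqP (l + sumn (behead kap)) m.
  have [|mu [mu_part kap_mu mu_lam mu_sum]] :=
    IHlam (behead kap) (m - l) kap'_part lam_part le_kap'.
    by move: m_le => /=; lia.
  exists (l :: mu); split.
  - by rewrite is_partition_cons l_gt0 mu_part (leq_trans (mu_lam 0)).
  - by case=> [|i] //=; rewrite -nth_behead.
  - by apply/contained_cons.
  - by rewrite /= mu_sum; lia.
have [m0|m_gt0] := posnP m.
  exists [::]; split=> //.
  - have -> : kap = [::]; last exact: contained_nil.
    case: (kap) kap_part kap_le_m => //= x s.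
    by rewrite is_partition_cons m0 => /andP[]; lia.
  - exact: contained_nil.
have le_head : nth 0 (behead kap) 0 <= nth 0 kap 0.
  by rewrite nth_behead; apply: nth_partition_le.
exists (m - sumn (behead kap) :: behead kap); split.
- rewrite is_partition_cons kap'_part andbT; apply/andP; split; last by lia.
  case: (kap) kap_part kap_le_m => [|x s] /=; first by lia.
  by rewrite is_partition_cons => /andP[]; lia.
- by case=> [|i] /=; rewrite ?nth_behead //; lia.
- by apply/contained_cons; split=> //; lia.
- by rewrite /=; lia.
Qed.

(** * Rectangles in a partition *)

(** A rectangle is the partition [nseq p q].  A diagram contains the cell (i, j)
    exactly when it contains the rectangle i.+1 x j.+1, so rectangles serve as
    cells that are themselves partitions. *)
Lemma contained_nseq (p q : nat) (s : seq nat) :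
  contained (nseq p q) s <-> forall i, i < p -> q <= nth 0 s i.
Proof.
split=> le_q i; last by rewrite nth_nseq; case: ifP => // /le_q.
by move=> lt_i; move: (le_q i); rewrite nth_nseq lt_i.
Qed.

Lemma contained_nseq_last (p q : nat) (s : seq nat) :
  is_partition s -> contained (nseq p.+1 q) s <-> q <= nth 0 s p.
Proof.
move=> s_part; rewrite contained_nseq; split=> [|le_q i]; first exact.
by rewrite ltnS => /(nth_partition_le _ _ _ s_part); apply: leq_trans.
Qed.

Lemma contained_nseq_sub (p q p' q' : nat) (s : seq nat) :
  p' <= p -> q' <= q -> contained (nseq p q) s -> contained (nseq p' q') s.
Proof.
move=> le_p le_q /contained_nseq rect; apply/contained_nseq=> i lt_i.
exact: leq_trans le_q (rect i (leq_trans lt_i le_p)).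
Qed.

Lemma sumn_two_rectangles (p q p' q' : nat) (s : seq nat) :
  p <= p' -> contained (nseq p q) s -> contained (nseq p' q') s ->
  p * q + (p' - p) * q' <= sumn s.
Proof.
move=> le_p /contained_nseq rect /contained_nseq rect'.
have /contained_sumn : contained (nseq p q ++ nseq (p' - p) q') s.
  move=> i; rewrite nth_cat size_nseq !nth_nseq.
  case: ltnP => [/rect //|le_i]; case: ifP => // lt_i.
  by apply: rect'; lia.
by rewrite sumn_cat !sumn_nseq; lia.
Qed.

Lemma sumn_rectangle (p q : nat) (s : seq nat) :
  contained (nseq p q) s -> p * q <= sumn s.
Proof. by move/contained_sumn; rewrite sumn_nseq mulnC. Qed.

Lemma is_partition_nseq (p q : nat) : 0 < q -> is_partition (nseq p q).
Proof.
move=> q_gt0; elim: p => // p IHp.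
rewrite /= is_partition_cons q_gt0 IHp nth_nseq.
by case: ifP => //=; rewrite leqnn.
Qed.

(** A deletion of [lam] that contains the rectangle carries it over to [nu]. *)
Lemma small_rectangle_transfer (k p q : nat) (lam nu : seq nat) :
  is_partition lam ->
  (forall mu, is_deletion k lam mu -> is_deletion k nu mu) ->
  p * q + k <= sumn lam ->
  contained (nseq p q) lam -> contained (nseq p q) nu.
Proof.
move=> lam_part del small rect.
(* [nseq p 0] is not a partition when p > 0, as its parts vanish. *)
have [->|q_gt0] := posnP q; first by apply/contained_nseq.
have [|mu [mu_part rect_mu mu_lam mu_sum]] := intermediate_partition
  (nseq p q) lam (sumn lam - k) (is_partition_nseq p q q_gt0) lam_part rect.
  by rewrite sumn_nseq; lia.
have /is_deletionP[_ mu_nu _] : is_deletion k nu mu.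
  by apply/del/is_deletionP; split=> //; lia.
by move=> i; apply: leq_trans (rect_mu i) (mu_nu i).
Qed.

(** * Two crossing rectangles *)

(** N stands for n - k.  The last three hypotheses bound what one partition is
    forced to contain of the rectangle of the other: the beginning of row a.+1,
    the beginning of column b'.+1, and a block of full height a. *)
Lemma crossing_areas_absurd (k N a b a' b' : nat) :
  k ^ 2 + k <= N -> a < a' -> b' < b ->
  N < a * b <= N + k -> N < a' * b' ->
  minn b' (N %/ a.+1) < k -> minn a (N %/ b'.+1) < k ->
  a * (N %/ a) + (a' - a) * b' <= N + k -> False.
Proof.
move=> N_ge lt_a lt_b /andP[ab_gt ab_le] ab'_gt.
rewrite !gtn_min !ltn_divLR // => /orP[b'_lt|a_large] /orP[a_lt|b'_large] block.
- (* Rounding loses less than a cells of the block, so a' * b' cannot exceed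
     k + (a - 1) + a * b' <= k ^ 2. *)
  have a_gt0 : 0 < a by case: (a) ab_gt.
  have := ltn_ceil N a_gt0; move: (N %/ a) block => q block block_ge.
  have : a' * b' = a * b' + (a' - a) * b' by rewrite -mulnDl subnKC // ltnW.
  have : a * b' <= k.-1 * k.-1 by apply: leq_mul; lia.
  by case: (k) a_lt N_ge block b'_lt => [|m] /=; nia.
- have : k * b'.+1 <= k * k by rewrite leq_mul2l b'_lt orbT.
  by rewrite mulnn; lia.
- have : k * a.+1 <= k * k by rewrite leq_mul2l a_lt orbT.
  by rewrite mulnn; lia.
(* Here k < a and N < k * b, whence k * (a * b) >= (k + 1) * (N + 1). *)
have a_gt : k.+1 <= a.
  rewrite -ltnS ltnNge; apply/negP=> le_a.
  have : k * a.+1 <= k * k.+1 by rewrite leq_mul2l le_a orbT.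
  by rewrite !mulnS mulnn; lia.
have b_gt : N.+1 <= k * b.
  by apply: (leq_trans b'_large); rewrite leq_mul2l lt_b orbT.
have := leq_mul a_gt b_gt; rewrite mulnCA.
have : k * (a * b) <= k * (N + k) by rewrite leq_mul2l ab_le orbT.
by rewrite mulnDr mulnn mulSn mulnS; lia.
Qed.

(** Both areas exceed N, since smaller rectangles belong to both partitions or
    to neither.  The subrectangles a.+1 x c, d x b'.+1 and a x (N %/ a) have
    area at most N, so they pass to the other partition, where the first two
    have fewer than k cells outside the large rectangle. *)
Lemma no_crossing_rectangles (k N a b a' b' : nat) (lam nu : seq nat) :
  k ^ 2 + k <= N ->
  is_partition lam -> is_partition nu ->
  sumn lam = N + k -> sumn nu = N + k ->
  (forall mu, is_deletion k lam mu <-> is_deletion k nu mu) ->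
  a < a' -> b' < b ->
  contained (nseq a b) lam -> ~ contained (nseq a b) nu ->
  contained (nseq a' b') nu -> ~ contained (nseq a' b') lam -> False.
Proof.
move=> N_ge lam_part nu_part lam_sum nu_sum del lt_a lt_b.
move=> rect_lam not_nu rect_nu not_lam.
have to_nu p q : p * q <= N ->
    contained (nseq p q) lam -> contained (nseq p q) nu.
  move=> small; apply: (small_rectangle_transfer k) => // [mu|]; last by lia.
  by move/del.
have to_lam p q : p * q <= N ->
    contained (nseq p q) nu -> contained (nseq p q) lam.
  move=> small; apply: (small_rectangle_transfer k) => // [mu|]; last by lia.
  by move/del.
have ab_gt : N < a * b by rewrite ltnNge; apply/negP=> /to_nu/(_ rect_lam)/not_nu.
have ab'_gt : N < a' * b'.
  by rewrite ltnNge; apply/negP=> /to_lam/(_ rect_nu)/not_lam.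
have ab_le : a * b <= N + k by rewrite -lam_sum; apply: sumn_rectangle.
apply: (crossing_areas_absurd k N a b a' b') => //; first by rewrite ab_gt.
- set c := minn _ _.
  have rect : contained (nseq a.+1 c) lam.
    apply: to_lam; last first.
      by apply: contained_nseq_sub rect_nu => //; apply: geq_minl.
    by rewrite mulnC -leq_divRL // geq_minr.
  by have := sumn_two_rectangles _ _ _ _ _ (leqnSn a) rect_lam rect; lia.
- set d := minn _ _.
  have le_d : d <= a by apply: geq_minl.
  have rect : contained (nseq d b'.+1) nu.
    apply: to_nu; last exact: contained_nseq_sub rect_lam.
    by rewrite -leq_divRL // geq_minr.
  have le_d' : d <= a' by lia.
  have := sumn_two_rectangles _ _ _ _ _ le_d' rect rect_nu.
  have : a' * b' = d * b' + (a' - d) * b' by rewrite -mulnDl subnKC.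
  by rewrite mulnS; lia.
have a_gt0 : 0 < a by case: (a) ab_gt.
rewrite -nu_sum; apply: sumn_two_rectangles => //; first exact: ltnW.
apply: to_nu; first by rewrite mulnC leq_divM.
apply: contained_nseq_sub rect_lam => //.
by rewrite ltnW // ltn_divLR // mulnC.
Qed.

Lemma exists_missing_rectangle (lam nu : seq nat) :
  is_partition lam -> is_partition nu -> sumn lam = sumn nu -> lam <> nu ->
  exists a b, contained (nseq a b) lam /\ ~ contained (nseq a b) nu.
Proof.
move=> lam_part nu_part sum_eq neq.
have [/allP le_all|/allPn[i _ not_le]] :=
    boolP (all (fun i => nth 0 lam i <= nth 0 nu i) (iota 0 (size lam))).
  case: neq; apply: contained_eq => // i.
  have [lt_i|le_i] := ltnP i (size lam); last by rewrite nth_default.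
  by apply: le_all; rewrite mem_iota.
exists i.+1, (nth 0 lam i); split; first by apply/contained_nseq_last.
by move/(contained_nseq_last _ _ _ nu_part)/(negP not_le).
Qed.

Theorem theorem1 (k n : nat) (k_gt0 : 0 < k) (n_ge : k ^ 2 + 2 * k <= n)
    (lam nu : seq nat)
    (lam_part : is_partition_of n lam) (nu_part : is_partition_of n nu)
    (same_deletions : forall mu : seq nat,
       is_deletion k lam mu <-> is_deletion k nu mu) :
  lam = nu.
Proof.
case/andP: lam_part => lam_part /eqP lam_sum.
case/andP: nu_part => nu_part /eqP nu_sum.
apply/eqP/negPn/negP=> /eqP neq.
have [||a [b [rect_lam not_nu]]] :=
    exists_missing_rectangle lam nu lam_part nu_part.
- by rewrite lam_sum.
- exact: neq.
have [||a' [b' [rect_nu not_lam]]] :=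
    exists_missing_rectangle nu lam nu_part lam_part.
- by rewrite nu_sum.
- by move=> eq; apply: neq.
have N_ge : k ^ 2 + k <= n - k by lia.
have n_split : n = n - k + k by lia.
have [le_a|lt_a] := leqP a' a; have [le_b|lt_b] := leqP b' b.
- by apply: not_lam; apply: contained_nseq_sub rect_lam.
- have [eq_a|neq_a] := eqVneq a' a.
    by apply: not_nu; apply: contained_nseq_sub rect_nu; lia.
  apply: (no_crossing_rectangles k (n - k) a' b' a b nu lam) => //; try lia.
  by move=> mu; split=> /same_deletions.
- have [eq_b|neq_b] := eqVneq b' b.
    by apply: not_nu; apply: contained_nseq_sub rect_nu; lia.
  by apply: (no_crossing_rectangles k (n - k) a b a' b' lam nu) => //; lia.
- by apply: not_nu; apply: contained_nseq_sub rect_nu; lia.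
Qed.
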